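(* If a countable group $G$ is framenable, then $G$ does not satisfy property (T).
   Context: ''Countable'' means countably infinite; groups are discrete. Hilbert spaces are complex and separable; $\mathcal U(H)$ is the group of unitary operators on $H$. For a unitary representation $\pi:G\to\mathcal U(H)$, $1_G\prec\pi$ means that there is a net $(v_i)_{i\in I}$ of unit vectors in $H$ with $\|\pi_g v_i-v_i\|\to0$ for every $g\in G$. A countable discrete group $G$ is framenable if there exist a unitary representation $\pi:G\to\mathcal U(H)$ with $1_G\prec\pi$, a countable (infinite) subset $S\subset G$, and a vector $v\in H$ such that $\{\pi_g v\}_{g\in S}$ is a weak frame. A family $\{f_n\}_{n\in S}$ in $H$ indexed by a countable set $S$ is a weak frame if $0<\sum_{n\in S}|\langle v,f_n\rangle|^2<\infty$ for every $v\in H$, $v\ne0$. A countable group $G$ satisfies property (T) if every unitary representation $\pi:G\to\mathcal U(H)$ with $1_G\prec\pi$ has a nonzero $G$-invariant vector $w$, i.e. $\pi_g w=w$ for all $g\in G$. *)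

(* Defs.v *)
From HB Require Import structures.
From mathcomp Require Import all_boot all_order all_algebra sesquilinear.
From mathcomp Require Import complex.
From mathcomp Require Import all_classical all_reals all_analysis.

Set Implicit Arguments.
Unset Strict Implicit.
Unset Printing Implicit Defensive.

Import Order.TTheory GRing.Theory Num.Theory.
Import numFieldNormedType.Exports.

Local Open Scope classical_set_scope.
Local Open Scope ring_scope.
Local Open Scope complex_scope.

Definition countably_infinite (T : Type) (A : set T) : Prop :=
  (A #= [set: nat])%card.

(* As in sesquilinear.v, inner products are linear in the first argument and
   conjugate-linear in the second; norms take their values in R[i]. *)
Record hilbertSpace (R : realType) := HilbertSpace {
  hilbert_sort :> completeNormedModType R[i] ;
  inner : {dot hilbert_sort for Num.conj} ;
  inner_norm : forall x : hilbert_sort, `|x| ^+ 2 = inner x x ;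
  hilbert_separable : exists2 D : set hilbert_sort, countable D & dense D
}.

Arguments inner {R} h.

Definition unitary_operator (R : realType) (H : hilbertSpace R)
    (u : {linear H -> H}) : Prop :=
  bijective u /\ isometry (inner H) (inner H) u.

Record unitaryRep (R : realType) (G : groupType) (H : hilbertSpace R) :=
  UnitaryRep {
    rep_op :> G -> {linear H -> H} ;
    rep_unitary : forall g, unitary_operator (rep_op g) ;
    rep1 : forall v, rep_op 1%g v = v ;
    repM : forall g h v, rep_op (g * h)%g v = rep_op g (rep_op h v)
  }.

Record directedSet := DirectedSet {
  dir_sort :> Type ;
  dir_le : dir_sort -> dir_sort -> Prop ;
  dir_inhabited : inhabited dir_sort ;
  dir_refl : forall i, dir_le i i ;
  dir_trans : forall i j k, dir_le i j -> dir_le j k -> dir_le i k ;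
  dir_bound : forall i j, exists k, dir_le i k /\ dir_le j k
}.

(* The filter of eventual sets: a net x converges to l iff x @ tails I --> l. *)
Definition tails (I : directedSet) : set_system I :=
  [set A | exists i0, forall i, dir_le i0 i -> A i].
Arguments tails : clear implicits.

Definition weakly_contains_trivial (R : realType) (G : groupType)
    (H : hilbertSpace R) (pi : unitaryRep G H) : Prop :=
  exists (I : directedSet) (v : I -> H),
    (forall i, `|v i| = 1) /\
    (forall g, (fun i => `|pi g (v i) - v i| : (R[i] : numFieldType))
                 @ tails I --> (0 : (R[i] : numFieldType))).

Definition weak_frame (R : realType) (H : hilbertSpace R) (T : choiceType)
    (S : set T) (f : T -> H) : Prop :=
  countably_infinite S /\
  forall v : H, v != 0 ->
    (0 < \esum_(n in S) (Normc.normc (inner H v (f n)) ^+ 2)%:E < +oo)%E.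

Definition framenable (R : realType) (G : groupType) : Prop :=
  exists (H : hilbertSpace R) (pi : unitaryRep G H),
    weakly_contains_trivial pi /\
    exists (S : set G) (v : H),
      countably_infinite S /\ weak_frame S (fun g => pi g v).

Definition property_T (R : realType) (G : groupType) : Prop :=
  forall (H : hilbertSpace R) (pi : unitaryRep G H),
    weakly_contains_trivial pi ->
    exists w : H, w != 0 /\ forall g, pi g w = w.

(* Main.v *)
Require Import Defs.
From HB Require Import structures.
From mathcomp Require Import all_boot all_order all_algebra sesquilinear.
From mathcomp Require Import complex finmap.
From mathcomp Require Import all_classical all_reals all_analysis.

Import Order.TTheory GRing.Theory Num.Theory.

(** Property (T) applied to the representation that carries the frame yields
    an invariant vector w != 0.  Since each pi g is unitary and fixes w, the
    coefficient <w, pi g v> = <pi g w, pi g v> = <w, v> does not depend on g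
    ([inner_invariant_orbit]).  The frame sum of w is therefore the sum of one
    nonnegative constant over an infinite set, which is 0 or +oo
    ([esum_cst_infinite]); both values are excluded for a weak frame. *)

Local Open Scope classical_set_scope.
Local Open Scope ring_scope.

(** Subsets of arbitrarily large finite cardinality n contribute n * c, and
    the reals are Archimedean. *)
Lemma esum_cst_infinite (R : realType) (T : choiceType) (S : set T) (c : R) :
  infinite_set S -> 0 < c -> (\esum_(i in S) c%:E = +oo)%E.
Proof.
move=> infS c0; apply/eqyP => t t0; apply: esum_ge.
have [B BS leB] := infinite_set_fset (Num.bound (t / c)) infS.
exists [set` B]; first by split.
rewrite -fsbig_seq ?fset_uniq// sumEFin lee_fin big_const_seq count_predT.
rewrite iter_addr_0 -mulr_natl -ler_pdivrMr//.
apply: (@le_trans _ _ (Num.bound (t / c))%:R); last by rewrite ler_nat.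
by apply/ltW/archi_boundP; rewrite divr_ge0 ?ltW.
Qed.

Lemma inner_invariant_orbit (R : realType) (G : groupType) (H : hilbertSpace R)
    (pi : unitaryRep G H) (w v : H) (g : G) :
  pi g w = w -> inner H w (pi g v) = inner H w v.
Proof.
by move=> wg; have [_ iso] := rep_unitary pi g; rewrite -{1}wg iso.
Qed.

Theorem proposition3p7 (R : realType) (G : groupType)
    (G_countable : countably_infinite [set: G])
    (G_framenable : framenable R G) : ~ property_T R G.
Proof.
move=> propT; case: G_framenable => H [pi [wct [S [v [Sinf [_ frame]]]]]].
have [w [w0 w_inv]] := propT H pi wct.
have infS : infinite_set S.
  by apply/infiniteP; move/card_eqPle: Sinf => -[].
have := frame w w0.
under eq_esum do rewrite inner_invariant_orbit//.
have := sqr_ge0 (Normc.normc (inner H w v)).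
rewrite le_eqVlt => /predU1P[<-|c0]; first by rewrite esum1// ltxx.
by rewrite esum_cst_infinite// ltxx andbF.
Qed.
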